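(* Let $E$ be a finite set and $\mathcal{L}\subseteq 2^E$. If $\mathcal{L}$ is inductively toggle-alternating, then $\mathcal{L}$ is toggle-alternating.
   Context: For a finite set $E$ and $\mathcal{L}\subseteq 2^E$, the toggle of $e\in E$ is the map $t_e:\mathcal{L}\to\mathcal{L}$ with $t_e(X)=X\cup\{e\}$ if $e\notin X$ and $X\cup\{e\}\in\mathcal{L}$; $t_e(X)=X\setminus\{e\}$ if $e\in X$ and $X\setminus\{e\}\in\mathcal{L}$; and $t_e(X)=X$ otherwise. The (generalized) toggle group $T(\mathcal{L})$ is the subgroup of the symmetric group $\mathfrak{S}_{\mathcal{L}}$ generated by $\{t_e \mid e\in E\}$. $\mathcal{L}$ is toggle-alternating if $T(\mathcal{L})$ contains the alternating group $A_{\mathcal{L}}$. An essentialization of $(\mathcal{L},E)$ is a pair $(\mathcal{L}',E')$ obtained as follows. Every $e\in E'$ must be an element of $E$ such that there exist $X,Y\in\mathcal{L}$ with $e\in X$ and $e\notin Y$ (no element of $E'$ lies in all or in none of the subsets in $\mathcal{L}$). Also, if $Z\subseteq E$, $|Z|>1$, is such that whenever $e\in Z$ and $e\in W\in\mathcal{L}$ we have $Z\subseteq W$, then for any maximal such $Z$ all elements of $Z$ except one are excluded from $E'$. All other elements of $E$ are kept in $E'$. Finally $\mathcal{L}'=\{X\cap E' \mid X\in\mathcal{L}\}$. For $e\in E$ put $\mathcal{L}_e=\{X\in\mathcal{L}\mid e\in X\}$ and $\mathcal{L}_{\bar e}=\{X\in\mathcal{L}\mid e\notin X\}$, and for $S\subseteq\mathcal{L}$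 put $t_e(S)=\{t_e(X)\mid X\in S\}$ (with $t_e$ the toggle on $\mathcal{L}$). Inductively toggle-alternating is defined recursively: $\mathcal{L}\subseteq 2^E$, with essentialization $(\mathcal{L}',E')$, is inductively toggle-alternating if (1) in case $|E'|\le 4$: $\mathcal{L}$ is toggle-alternating; (2) in case $|E'|\ge 5$: there exists $e\in E'$ such that at least one of the following holds: (a) $\mathcal{L}_e$ is inductively toggle-alternating, $\mathcal{L}_e\cup t_e(\mathcal{L}_e)=\mathcal{L}$, and $\mathcal{L}_e\cap t_e(\mathcal{L}_e)\neq\emptyset$; or (b) $\mathcal{L}_{\bar e}$ is inductively toggle-alternating, $\mathcal{L}_{\bar e}\cup t_e(\mathcal{L}_{\bar e})=\mathcal{L}$, and $\mathcal{L}_{\bar e}\cap t_e(\mathcal{L}_{\bar e})\neq\emptyset$. *)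

(* Defs.v *)
From mathcomp Require Import all_boot all_fingroup all_solvable.

Set Implicit Arguments.
Unset Strict Implicit.
Unset Printing Implicit Defensive.

Section Toggles.
Variable E : finType.
Implicit Types (L : {set {set E}}) (X Z : {set E}) (e : E).

Definition toggle L e X : {set E} :=
  if e \notin X then (if e |: X \in L then e |: X else X)
  else (if X :\ e \in L then X :\ e else X).

Lemma toggle_in L e X : X \in L -> toggle L e X \in L.
Proof. by rewrite /toggle => XL; do 2?case: ifP. Qed.

Lemma toggleK L e X : X \in L -> toggle L e (toggle L e X) = X.
Proof.
move=> XL; rewrite /toggle.
have [eX|eX] := boolP (e \in X).
  by have [XeL|/negPf XeL] := boolP (X :\ e \in L);
    rewrite /= ?setD11 /= ?setD1K ?XL ?eX //= XeL.
by have [XeL|/negPf XeL] := boolP (e |: X \in L);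
  rewrite /= ?setU11 /= ?setU1K ?XL ?eX //= XeL.
Qed.

Definition toggle_map L e (u : {X : {set E} | X \in L}) :
    {X : {set E} | X \in L} :=
  exist _ (toggle L e (val u)) (toggle_in e (valP u)).

Lemma toggle_mapK L e : involutive (@toggle_map L e).
Proof. by case=> X XL; apply/val_inj/toggleK. Qed.

Definition toggle_perm L e : {perm {X : {set E} | X \in L}} :=
  perm (inv_inj (@toggle_mapK L e)).

Definition toggle_group L : {group {perm {X : {set E} | X \in L}}} :=
  <<[set toggle_perm L e | e : E]>>%G.

Definition toggle_alternating L : bool :=
  ('Alt_{X : {set E} | X \in L})%g \subset toggle_group L.

Definition essential L e : bool :=
  [exists X in L, e \in X] && [exists Y in L, e \notin Y].

Definition clump L Z : bool :=
  (1 < #|Z|) && [forall e in Z, forall W in L, (e \in W) ==> (Z \subset W)].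

(* R is the set of elements excluded as redundant; since R is a choice, a    *)
(* family generally has several essentializations.                           *)
Definition essentialization L (L' : {set {set E}}) (E' : {set E}) : Prop :=
  exists R : {set E},
    [/\ forall Z, maxset (clump L) Z -> #|Z :\: R| = 1,
        forall e, e \in R -> exists2 Z, maxset (clump L) Z & e \in Z,
        E' = [set e | essential L e] :\: R
      & L' = [set X :&: E' | X in L]].

Definition with_elt L e : {set {set E}} := [set X in L | e \in X].
Definition without_elt L e : {set {set E}} := [set X in L | e \notin X].

(* A least fixed point encodes the recursion: since e is essential, both     *)
(* with_elt L e and without_elt L e are proper subfamilies of L.             *)
Inductive inductively_toggle_alternating : {set {set E}} -> Prop :=
| ITA_small L L' E' :
    essentialization L L' E' -> #|E'| <= 4 ->
    toggle_alternating L ->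
    inductively_toggle_alternating L
| ITA_with L L' E' e :
    essentialization L L' E' -> 5 <= #|E'| -> e \in E' ->
    inductively_toggle_alternating (with_elt L e) ->
    with_elt L e :|: toggle L e @: with_elt L e = L ->
    with_elt L e :&: toggle L e @: with_elt L e <> set0 ->
    inductively_toggle_alternating L
| ITA_without L L' E' e :
    essentialization L L' E' -> 5 <= #|E'| -> e \in E' ->
    inductively_toggle_alternating (without_elt L e) ->
    without_elt L e :|: toggle L e @: without_elt L e = L ->
    without_elt L e :&: toggle L e @: without_elt L e <> set0 ->
    inductively_toggle_alternating L.

End Toggles.

(* Main.v *)
Require Import Defs.
From mathcomp Require Import all_boot all_fingroup all_solvable.

(* Let A be the half of L (sets containing e, or sets avoiding e) given by    *)
(* the recursion, t the toggle at e, and B the complement of A in L. Toggles  *)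
(* at elements other than e preserve A, so every even permutation of A is     *)
(* induced on A by some element of the toggle group G of L. The five          *)
(* essential elements force |A| >= 3, and t embeds B into A with A and t(A)   *)
(* meeting, so 0 < |B| < |A|. Let N consist of the even permutations of A     *)
(* whose extension by the identity on B lies in G; it is normal in Alt(A).    *)
(* If |B| <= 2, squares of lifts are trivial on B, and every 3-cycle is a     *)
(* square, so N = Alt(A). Otherwise N is nontrivial, since |A|!/2 > |B|!, so  *)
(* N = Alt(A) by simplicity when |A| >= 5. Once N = Alt(A), conjugating by t  *)
(* and gluing along the overlap of A and t(A) yields Alt(L). In the remaining *)
(* case |A| = 4 and |B| = 3, N is only known to be transitive, but A and t(A) *)
(* meet in a single point p, and the commutator of an element of N with the   *)
(* t-conjugate of another is a 3-cycle through p.                             *)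

(** The induction step [toggle_alternating_step] rests on a statement about permutation groups,
    [Alt_sub_lift]; toggles enter it through [lifts_toggle_group] and the size bound [card_half]. To
    show that a group contains the alternating group, all transpositions are put in one class, two
    being linked when their product is in the group. [Alt_sub_glue] does this when N = Alt(A),
    [Alt_sub_star] in the exceptional case |A| = 4, |B| = 3. *)

Set Implicit Arguments.
Unset Strict Implicit.
Unset Printing Implicit Defensive.

Local Open Scope group_scope.

(** * Alternating groups from products of two transpositions *)

Section Transpositions.
Variables (T : finType) (G : {group {perm T}}).

Lemma tperm_mulC_in x y z w :
  tperm x y * tperm z w \in G -> tperm z w * tperm x y \in G.
Proof. by move/groupVr; rewrite invMg !tpermV. Qed.

Lemma tperm_mul_trans x y a b z w :
    tperm x y * tperm a b \in G -> tperm a b * tperm z w \in G ->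
  tperm x y * tperm z w \in G.
Proof.
move=> Gxa Gaz; have := groupM Gxa Gaz.
by rewrite mulgA -(mulgA (tperm x y)) tperm2 mulg1.
Qed.

Lemma tperm_mulJ g x y z w :
    g \in G -> tperm x y * tperm z w \in G ->
  tperm (g x) (g y) * tperm (g z) (g w) \in G.
Proof. by move=> Gg; rewrite -!tpermJ -conjMg groupJr. Qed.

(* On transpositions, [x * y \in G] is an equivalence relation; G contains   *)
(* the alternating group as soon as there is a single class.                  *)
Lemma Alt_sub_tperm2 :
    (forall x y z w, x != y -> z != w -> tperm x y * tperm z w \in G) ->
  'Alt_T \subset G.
Proof.
move=> GP; apply/subsetP=> s; rewrite Alt_even.
have [ts -> dts] := prod_tpermP s; rewrite odd_perm_prod //.
have [n] := ubnP (size ts).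
elim: n ts dts => // n IHn [|[x y] [|[z w] ts]] //=.
  by rewrite big_nil group1.
case/and3P=> xy zw dts; rewrite ltnS negbK => /ltnW lt_n ev.
by rewrite !big_cons /= mulgA groupM ?GP ?IHn.
Qed.

Lemma Alt_sub_tpermM a b :
  (forall x y, x != y -> tperm x y * tperm a b \in G) -> 'Alt_T \subset G.
Proof.
move=> Gab; apply: Alt_sub_tperm2 => x y z w xy zw.
by apply: tperm_mul_trans (Gab _ _ xy) _; apply/tperm_mulC_in/Gab.
Qed.

(** Both [tperm x y] and [tperm z w] share a point with [tperm x z], which links them. *)
Lemma Alt_sub_cycle3 :
    (forall x y z, x != y -> x != z -> y != z -> tperm x y * tperm x z \in G) ->
  'Alt_T \subset G.
Proof.
move=> G3; apply: Alt_sub_tperm2 => x y z w xy zw.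
have G3' a b c : a != b -> a != c -> tperm a b * tperm a c \in G.
  by have [<-|bc] := eqVneq b c; [rewrite tperm2 group1 | move=> *; apply: G3].
have [xz|xz] := eqVneq x z; first by rewrite -xz in zw *; exact: G3'.
apply: tperm_mul_trans (G3' x y z xy xz) _.
by rewrite (tpermC x); apply: G3'; rewrite // eq_sym.
Qed.

End Transpositions.

(** * Lifting along an injection, and the normal subgroup N *)

Section Extension.
Variables (S T : finType) (f : S -> T) (G : {group {perm T}}).
Hypothesis f_inj : injective f.
Implicit Types (s : {perm S}) (g h : {perm T}).

(** Off the image of [f] the lift is unconstrained; [extends] also asks it to be the identity
    there. *)
Definition lifts g s := [forall i, g (f i) == f (s i)].

Lemma liftsP g s : reflect (forall i, g (f i) = f (s i)) (lifts g s).
Proof. exact: 'forall_eqP. Qed.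

Lemma lifts1 : lifts 1 1.
Proof. by apply/liftsP=> i; rewrite !perm1. Qed.

Lemma liftsM g h s r : lifts g s -> lifts h r -> lifts (g * h) (s * r).
Proof.
by move=> /liftsP gs /liftsP hr; apply/liftsP=> i; rewrite !permM gs hr.
Qed.

Lemma liftsV g s : lifts g s -> lifts g^-1 s^-1.
Proof.
by move=> /liftsP gs; apply/liftsP=> i; rewrite -{1}(permKV s i) -gs permK.
Qed.

Lemma lifts_codom g s :
  lifts g s -> forall x, (g x \in codom f) = (x \in codom f).
Proof.
move=> gs x; apply/codomP/codomP=> [[i gx]|[i ->]]; last first.
  by exists (s i); rewrite (liftsP _ _ gs).
exists (s^-1 i); apply: (@perm_inj _ g).
by rewrite (liftsP _ _ gs) permKV.
Qed.

Definition extends g s := lifts g s && perm_on [set x in codom f] g.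

(** This is N, with [f] as the inclusion of A. *)
Definition Alt_part := [set s in 'Alt_S | [exists g in G, extends g s]].

Lemma Alt_partP s :
  reflect (s \in 'Alt_S /\ exists2 g, g \in G & extends g s) (s \in Alt_part).
Proof.
by apply: (iffP setIdP) => -[As /exists_inP].
Qed.

Lemma group_set_Alt_part : group_set Alt_part.
Proof.
apply/group_setP; split.
  apply/Alt_partP; split; first exact: group1.
  by exists 1; rewrite /extends ?group1 ?lifts1 ?perm_on1.
move=> s r /Alt_partP[As [g Gg /andP[gs g_on]]].
case/Alt_partP=> Ar [h Gh /andP[hr h_on]].
apply/Alt_partP; split; first exact: groupM.
by exists (g * h); rewrite /extends ?groupM ?liftsM ?perm_onM.
Qed.

Canonical Alt_part_group := Group group_set_Alt_part.

Lemma extends_tperm2 g x y z w :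
    extends g (tperm x y * tperm z w) ->
  g = tperm (f x) (f y) * tperm (f z) (f w).
Proof.
case/andP=> /liftsP gE g_on; apply/permP=> u.
have [/codomP[i ->]|uf] := boolP (u \in codom f).
  by rewrite gE !permM !(inj_tperm _ _ _ f_inj).
have uE i : (f i == u) = false.
  by apply: contraNF uf => /eqP<-; apply: codom_f.
by rewrite (out_perm g_on) ?inE // permM !tpermD ?uE.
Qed.

Lemma Alt_part_tperm2 x y z w :
    'Alt_S \subset Alt_part -> x != y -> z != w ->
  tperm (f x) (f y) * tperm (f z) (f w) \in G.
Proof.
move=> /subsetP sAN xy zw.
have /sAN/Alt_partP[_ [g Gg /extends_tperm2 <-//]] :
  tperm x y * tperm z w \in 'Alt_S.
by rewrite Alt_even odd_mul_tperm odd_tperm xy zw.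
Qed.

Hypothesis Alt_lift : forall s, s \in 'Alt_S -> exists2 h, h \in G & lifts h s.

(** A lift of r preserves the image of [f], so conjugating by it keeps supports inside that
    image. *)
Lemma Alt_part_normal : Alt_part <| 'Alt_S.
Proof.
apply/andP; split; first by apply/subsetP=> s /Alt_partP[].
apply/subsetP=> r Ar; rewrite inE; apply/subsetP=> _ /imsetP[s + ->].
case/Alt_partP=> As [g Gg /andP[gs g_on]].
have [h Gh hr] := Alt_lift Ar.
apply/Alt_partP; split; first by rewrite groupJ.
exists (g ^ h); first by rewrite groupJ.
rewrite /extends /conjg !liftsM ?liftsV //=.
apply/subsetP=> x; rewrite unfold_in -/(g ^ h) -{1 2}(permKV h x) permJ.
rewrite inE -(lifts_codom (liftsV hr)).
by rewrite (inj_eq perm_inj) => /(subsetP g_on); rewrite inE.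
Qed.

(* Otherwise even permutations would be determined by the restriction of a    *)
(* lift to the complement of the image of f, so #|S|`!/2 <= (#|S| - 1)`!.     *)
Lemma Alt_part_neq1 : 2 < #|S| -> #|~: [set x in codom f]| < #|S| ->
  Alt_part :!=: 1.
Proof.
set B := ~: _ => S2 BS; apply/negP=> /eqP N1.
pose lift s := odflt 1 [pick h in G | lifts h s].
have liftG s : s \in 'Alt_S -> lift s \in G /\ lifts (lift s) s.
  case/Alt_lift=> h Gh hs; rewrite /lift; case: pickP => [k /andP[]|/(_ h)] //.
  by rewrite Gh hs.
have liftB s : s \in 'Alt_S -> lift s \in 'N(B | 'P).
  case/liftG=> _ hs; rewrite inE in_setT /=; rewrite inE; apply/subsetP=> x.
  by rewrite !inE /= apermE (lifts_codom hs).
pose res s := restr_perm B (lift s).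
have res_inj : {in 'Alt_S &, injective res}.
  move=> s r As Ar eq_res.
  (* If the restrictions agree, the quotient of the two lifts is trivial on [B], so s r^-1 lies in N
     = 1. *)
  have [[Gs ls] [Gr lr]] := (liftG s As, liftG r Ar).
  apply/eqP; rewrite eq_mulgV1; apply/eqP/set1P.
  have <- : Alt_part = [set 1] by [].
  apply/Alt_partP; split; first by rewrite groupM ?groupV.
  exists (lift s * (lift r)^-1); first by rewrite groupM ?groupV.
  rewrite /extends liftsM ?liftsV //=; apply/subsetP=> x; rewrite unfold_in.
  apply: contraR => xA; have xB : x \in B by rewrite inE.
  have /permP/(_ x) := eq_res.
  by rewrite !restr_permE ?liftB // permM => ->; rewrite permK.
have leAB : #|'Alt_S| <= #|B|`!.
  rewrite -card_perm -(card_in_imset res_inj) subset_leq_card //.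
  by apply/subsetP=> _ /imsetP[s As ->]; apply: restr_perm_on.
have := card_Alt (ltnW S2).
have {}leAB : #|'Alt_S| <= (#|S|.-1)`!.
  apply: leq_trans leAB _.
  by rewrite leq_fact // -ltnS prednK // (ltn_trans _ S2).
(* Doubling gives n! <= 2 (n-1)! for n = [#|S|], against n > 2. *)
move=> cS; move: leAB; rewrite -(leq_pmul2l (isT : 0 < 2)) cS.
case: #|S| S2 => // n n1; rewrite factS leq_pmul2r ?fact_gt0 //=.
by rewrite leqNgt n1.
Qed.

Lemma Alt_part_small_compl :
  #|~: [set x in codom f]| <= 2 -> 'Alt_S \subset Alt_part.
Proof.
set B := ~: _ => B2; apply: Alt_sub_cycle3 => x y z xy xz yz.
set c := tperm x y * tperm x z.
have Ac : c \in 'Alt_S by rewrite Alt_even odd_mul_tperm odd_tperm xy xz.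
have c4 : c * c * (c * c) = c.
  have cx : c x = y by rewrite permM tpermL tpermD // eq_sym.
  have cy : c y = z by rewrite permM tpermR tpermL.
  have cz : c z = x by rewrite permM (tpermD xz) // tpermR.
  have c3 : c * c * c = 1.
    apply/permP=> u; rewrite 2!permM perm1.
    have [->|ux] := eqVneq u x; first by rewrite cx cy cz.
    have [->|uy] := eqVneq u y; first by rewrite cy cz cx.
    have [->|uz] := eqVneq u z; first by rewrite cz cx cy.
    have cu : c u = u by rewrite permM !tpermD // eq_sym.
    by rewrite !cu.
  by rewrite mulgA c3 mul1g.
(* The square of a lift of [c * c] lifts [c], and it is trivial on [B]: otherwise [h] would have
   three distinct points of [B] in one orbit. *)
have [h Gh hc] := Alt_lift (groupM Ac Ac).
apply/Alt_partP; split=> //; exists (h * h); first exact: groupM.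
rewrite /extends -[c]c4 liftsM //=; apply/subsetP=> u; rewrite unfold_in.
apply: contraR => uA; rewrite permM.
have uB : u \in B by rewrite inE.
have hB v : v \in B -> h v \in B by rewrite !inE (lifts_codom hc).
have [huu|huu] := eqVneq (h u) u; first by rewrite !huu.
have [//|hhu] := eqVneq (h (h u)) u.
have : #|[set u; h u; h (h u)]| <= 2.
  apply: leq_trans B2; apply/subset_leq_card.
  by rewrite !subUset !sub1set !hB ?uB.
rewrite -setUA !cardsU1 cards1 !inE eq_sym negb_or huu eq_sym hhu.
by rewrite eq_sym (inj_eq perm_inj) huu.
Qed.

Lemma Alt_part_ge5 : 4 < #|S| -> Alt_part :!=: 1 -> 'Alt_S \subset Alt_part.
Proof.
move=> S5 N1; have /simpleP[_ /(_ _ Alt_part_normal)[N|N]] := simple_Alt5 S5.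
  by rewrite N eqxx in N1.
by rewrite -{1}N.
Qed.

(** From four points on, Alt(S) is 2-transitive, hence primitive, and a nontrivial normal subgroup
    of a faithful primitive group is transitive. *)
Lemma Alt_part_trans (i j : S) : 3 < #|S| -> Alt_part :!=: 1 ->
  exists g, [/\ g \in G, perm_on [set x in codom f] g & g (f i) = f j].
Proof.
move=> S4 N1.
have tr2 : [transitive^2 'Alt_S, on setT | 'P].
  by apply: ntransitive_weak (Alt_trans S); rewrite -(subnKC S4).
have prim := ntransitive_primitive (isT : 1 < 2) tr2.
have [NC|Ntr] := prim_trans_norm prim Alt_part_normal.
  case/negP: N1; apply/eqP/trivgP.
  exact: subset_trans NC (aperm_faithful _).
have /imsetP[s Ns ->] : j \in orbit 'P Alt_part i by rewrite (atransP Ntr) ?inE.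
case/Alt_partP: Ns => _ [g Gg /andP[/liftsP gs g_on]].
by exists g; split=> //; rewrite gs.
Qed.

End Extension.

(** * Gluing along the overlap of A and t(A) *)

Section Gluing.
Variables (T : finType) (G : {group {perm T}}) (A : {set T}) (t : {perm T}).
Hypotheses (Gt : t \in G) (tK : involutive t).
Hypothesis t_cover : forall x, x \notin A -> t x \in A.
Variables p y0 : T.
Hypotheses (Ap : p \in A) (Atp : t p \in A) (Ay0 : y0 \notin A).

Lemma Alt_sub_glue :
    2 < #|A| ->
    {in A & A, forall x y, x != y ->
      {in A & A, forall z w, z != w -> tperm x y * tperm z w \in G}} ->
  'Alt_T \subset G.
Proof.
move=> A3 GA.
have third a b : exists2 c, c \in A & (c != a) && (c != b).
  have /subsetPn[c Ac] : ~~ (A \subset [set a; b]).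
    apply/negP=> /subset_leq_card; rewrite leqNgt (leq_ltn_trans _ A3) //.
    by rewrite cards2; case: (_ != _).
  by rewrite !inE negb_or; exists c.
have t_inj x y : (t x == t y) = (x == y) by rewrite (inj_eq perm_inj).
have GtA x y z w : t x \in A -> t y \in A -> t z \in A -> t w \in A ->
    x != y -> z != w -> tperm x y * tperm z w \in G.
  move=> Ax Ay Az Aw xy zw.
  by rewrite -[x]tK -[y]tK -[z]tK -[w]tK tperm_mulJ // GA // t_inj.
have neqA x y : x \in A -> y \notin A -> x != y.
  by move=> Ax; apply: contraNneq => <-.
(* A transposition with [x] in A only and [y] in t(A) only: the 3-cycle [c] on p, y, t v lives in
   t(A), fixes [x] and sends [p] to [y]. It carries the link between [tperm x p] and [tperm x q] to
   one between [tperm x y] and a transposition inside A. *)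
have mixed x y z w : x \in A -> t x \notin A -> y \notin A ->
    z \in A -> w \in A -> z != w -> tperm x y * tperm z w \in G.
  move=> Ax Atx Ay Az Aw zw.
  have [v Atv /andP[vp vy]] := third (t p) (t y).
  have [q Aq /andP[qx qp]] := third x p.
  have xp : x != p by apply: contraNneq Atx => ->.
  have py : p != y by apply: neqA.
  have yv : y != t v by rewrite -[y]tK t_inj eq_sym.
  have pv : p != t v by rewrite -[p]tK t_inj eq_sym.
  have xv : x != t v by apply: contraNneq Atx => ->; rewrite tK.
  pose c := tperm p y * tperm p (t v).
  have Gc : c \in G by apply: GtA; rewrite ?tK //; apply: t_cover.
  have cx : c x = x.
    rewrite permM (@tpermD _ p y) 1?eq_sym //; last exact: neqA.
    by rewrite tpermD // eq_sym.
  have cp : c p = y by rewrite permM tpermL tpermD // eq_sym.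
  have Acq : c q \in A.
    rewrite permM (@tpermD _ p y) 1?eq_sym //; last exact: neqA.
    by case: tpermP qp => // ->; rewrite eqxx.
  have /(tperm_mulJ Gc) : tperm x p * tperm x q \in G.
    by rewrite GA // eq_sym.
  rewrite cx cp => /tperm_mul_trans; apply; apply: GA => //.
  by rewrite -{1}cx (inj_eq perm_inj) eq_sym.
have [b Ab /andP[bp _]] := third p p.
(* Conjugation by [t] fixes this transposition, so its link to A also gives a link to t(A), merging
   the two classes. *)
have y0_link : tperm (t y0) y0 * tperm b p \in G.
  by apply: mixed; rewrite ?tK ?t_cover.
have GtA0 x y : t x \in A -> t y \in A -> x != y -> tperm x y * tperm b p \in G.
  move=> Ax Ay xy; have := tperm_mulJ Gt y0_link; rewrite tK tpermC.
  move/tperm_mulC_in/tperm_mul_trans/(_ y0_link); apply: tperm_mul_trans.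
  by rewrite GtA ?tK ?t_inj.
apply: (@Alt_sub_tpermM _ _ b p) => x y xy.
have [[Ax|Ax] [Ay|Ay]] := (boolP (x \in A), boolP (y \in A)).
- by rewrite GA.
- have [Atx|Atx] := boolP (t x \in A).
    by apply: GtA0 => //; apply: t_cover.
  by rewrite mixed.
- have [Aty|Aty] := boolP (t y \in A).
    by apply: GtA0 => //; apply: t_cover.
  by rewrite tpermC mixed.
- by apply: GtA0 => //; apply: t_cover.
Qed.

Lemma Alt_sub_star :
    {in A, forall x, t x \in A -> x = p} ->
    {in A & A, forall x y, exists g, [/\ g \in G, perm_on A g & g x = y]} ->
  'Alt_T \subset G.
Proof.
move=> meet1 trA.
have tp : t p = p by apply: meet1; rewrite ?tK.
have neqA x y : x \in A -> y \notin A -> x != y.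
  by move=> Ax; apply: contraNneq => <-.
(* Take g on A with g p = u and k = [h ^ t] on t(A) with k p = v. Their supports can meet only in
   [p], so the commutator of g and k is a 3-cycle on p, v, u. *)
have cycle u v : u \in A -> u != p -> v \notin A -> tperm p v * tperm p u \in G.
  move=> Au up Av; have Atv := t_cover Av.
  have [g [Gg g_on gp]] := trA p u Ap Au.
  have [h [Gh h_on hp]] := trA p (t v) Ap Atv.
  have kE x : (h ^ t) x = t (h (t x)) by rewrite -{1}[x]tK permJ.
  have k_fix x : x \in A -> x != p -> (h ^ t) x = x.
    move=> Ax xp; rewrite kE (out_perm h_on) ?tK //.
    by apply: contra xp => /(meet1 _ Ax) ->.
  have kp : (h ^ t) p = v by rewrite kE tp hp tK.
  suff -> : tperm p v * tperm p u = [~ g, h ^ t] by rewrite groupR ?groupJ.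
  have gKA x : x \in A -> g^-1 x \in A.
    by move=> Ax; rewrite -(perm_closed _ g_on) permKV.
  have gKout x : x \notin A -> g^-1 x = x by move/(out_perm (perm_onV g_on)).
  have gKneq x : x != u -> g^-1 x != p.
    by apply: contraNneq => /(canRL (permKV g)) ->; rewrite gp.
  have gJ x : (g ^ (h ^ t)) ((h ^ t) x) = (h ^ t) (g x) by rewrite permJ.
  have kout x : x \notin A :\ p -> x != v -> (g ^ (h ^ t)) x = x.
    move=> xAp xv; rewrite -[x](permKV (h ^ t)) gJ.
    set q := _ x; have kq : (h ^ t) q = x by rewrite permKV.
    congr (_ _); apply: (out_perm g_on); apply/negP=> Aq.
    have [qp|qp] := eqVneq q p; first by rewrite -kq qp kp eqxx in xv.
    by move: xAp; rewrite -kq k_fix // !inE qp Aq.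
  have pv := neqA _ _ Ap Av; have uv := neqA _ _ Au Av.
  apply/permP=> x; rewrite commgEl [RHS]permM permM.
  have [->|xp] := eqVneq x p.
    rewrite tpermL tpermD //.
    by rewrite -(k_fix (g^-1 p)) ?gKA ?gKneq // 1?eq_sym // gJ permKV kp.
  have [->|xv] := eqVneq x v.
    by rewrite tpermR tpermL gKout // -kp gJ gp k_fix.
  rewrite (@tpermD _ p v) 1?eq_sym //.
  have [->|xu] := eqVneq x u.
    by rewrite tpermR -gp permK kout // !inE eqxx.
  rewrite tpermD 1?eq_sym //.
  have [Ax|Ax] := boolP (x \in A); last first.
    by rewrite gKout // kout // !inE negb_and Ax orbT.
  by rewrite -(k_fix (g^-1 x)) ?gKA ?gKneq // gJ permKV k_fix.
have v0A := Ay0; have u0A := t_cover Ay0.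
have u0p : t y0 != p by apply: contraNneq v0A => u0E; rewrite -[y0]tK u0E tp.
have pu u : u \in A -> u != p -> tperm p u * tperm p (t y0) \in G.
  move=> Au up; apply: tperm_mul_trans (cycle _ _ u0A u0p v0A).
  exact/tperm_mulC_in/cycle.
have pv v : v \notin A -> tperm p v * tperm p (t y0) \in G by apply: cycle.
have uv u v : u \in A -> u != p -> v \notin A ->
    tperm u v * tperm p (t y0) \in G.
  move=> Au up Av; apply: tperm_mul_trans (pv v Av).
  (* Conjugating the 3-cycle by itself rotates its points, which links [tperm u v] to
     [tperm p v]. *)
  have := tperm_mulJ (cycle u v Au up Av) (cycle u v Au up Av).
  have pv' := neqA _ _ Ap Av; have uv' := neqA _ _ Au Av.
  have -> : (tperm p v * tperm p u) p = v.
    by rewrite permM tpermL tpermD // eq_sym.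
  have -> : (tperm p v * tperm p u) v = u by rewrite permM tpermR tpermL.
  have -> : (tperm p v * tperm p u) u = p.
    by rewrite permM (@tpermD _ p v) 1?eq_sym // tpermR.
  by rewrite (tpermC v u) (tpermC v p).
have uu u w : u \in A -> w \in A -> u != w ->
    tperm u w * tperm p (t y0) \in G.
  move=> Au Aw uw.
  have [u_p|up] := eqVneq u p; first by rewrite u_p pu // -u_p eq_sym.
  have [w_p|wp] := eqVneq w p; first by rewrite w_p tpermC pu.
  have [g [Gg g_on gp]] := trA p u Ap Au.
  have gKA x : x \in A -> g^-1 x \in A.
    by move=> Ax; rewrite -(perm_closed _ g_on) permKV.
  have gKneq x : x != u -> g^-1 x != p.
    by apply: contraNneq => /(canRL (permKV g)) ->; rewrite gp.
  apply: tperm_mul_trans (pu u Au up).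
  (* Transpositions through [p] are already linked; [g] carries this pair to [tperm u w] and
     [tperm u p]. *)
  have : tperm p (g^-1 w) * tperm p (g^-1 p) \in G.
    apply: tperm_mul_trans (tperm_mulC_in (pu _ _ _)); first apply: pu;
      by rewrite ?gKA ?gKneq // eq_sym.
  by move/(tperm_mulJ Gg); rewrite gp !permKV (tpermC u p).
apply: (@Alt_sub_tpermM _ _ p (t y0)) => x y xy.
have [[Ax|Ax] [Ay|Ay]] := (boolP (x \in A), boolP (y \in A)).
- exact: uu.
- by have [->|xp] := eqVneq x p; [apply: pv | apply: uv].
- by rewrite tpermC; have [->|yp] := eqVneq y p; [apply: pv | apply: uv].
have txp z : z \notin A -> t z != p.
  by move=> Az; apply: contraNneq Az => tz; rewrite -[z]tK tz tp.
have := tperm_mulJ Gt (uu _ _ (t_cover Ax) (t_cover Ay) _).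
rewrite !tK tp (inj_eq perm_inj) => /(_ xy)/tperm_mul_trans; apply.
exact: pv.
Qed.

End Gluing.

(** * The group-theoretic core of the induction step *)

Lemma Alt_sub_lift (S T : finType) (f : S -> T) (G : {group {perm T}})
    (t : {perm T}) p y :
    injective f -> 2 < #|S| ->
    (forall s, s \in 'Alt_S -> exists2 h, h \in G & lifts f h s) ->
    t \in G -> involutive t ->
    (forall x, x \notin codom f -> t x \in codom f) ->
    p \in codom f -> t p \in codom f -> y \notin codom f ->
  'Alt_T \subset G.
Proof.
move=> f_inj S3 f_lift Gt tK t_cov fp ftp fy.
pose A := [set x in codom f].
have inA x : (x \in A) = (x \in codom f) by rewrite inE.
have cardA : #|A| = #|S| by rewrite cardsE card_codom.
have t_covA x : x \notin A -> t x \in A by rewrite !inA; apply: t_cov.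
have [Ap Atp Ay] : [/\ p \in A, t p \in A & y \notin A] by rewrite !inA.
have tB x z : t x \in A -> z \in ~: A -> t z != x.
  by move=> Atx; rewrite inE; apply: contraNneq => tz; rewrite -[z]tK tz.
have sBA : t @: (~: A) \subset A :\ p.
  apply/subsetP=> _ /imsetP[z Bz ->].
  by rewrite in_setD1 tB // t_covA //; rewrite inE in Bz.
have cardB : #|~: A| < #|S|.
  rewrite -cardA -(card_imset _ (@perm_inj _ t)) (cardsD1 p A) Ap ltnS.
  exact: subset_leq_card.
suff [sAN|meet1] : 'Alt_S \subset Alt_part f G \/
    3 < #|S| /\ {in A, forall x, t x \in A -> x = p}.
- apply: (Alt_sub_glue (A := A) Gt tK t_covA Ap Atp Ay); first by rewrite cardA.
  move=> x y' Ax Ay' xy z w Az Aw zw.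
  move: Ax Ay' Az Aw xy zw; rewrite !inA => /codomP[i ->] /codomP[j ->].
  move=> /codomP[k ->] /codomP[l ->]; rewrite !(inj_eq f_inj).
  exact: Alt_part_tperm2.
- case: meet1 => S4 meet1.
  apply: (Alt_sub_star Gt tK t_covA Ap Atp Ay meet1) => x z.
  rewrite !inA => /codomP[i ->] /codomP[j ->].
  exact: Alt_part_trans (Alt_part_neq1 _ _ _).
have [B2|B3] := leqP #|~: A| 2; first by left; apply: Alt_part_small_compl.
have N1 := Alt_part_neq1 f_lift S3 cardB.
have [S5|S4] := ltnP 4 #|S|; first by left; apply: Alt_part_ge5.
right; split=> [|x Ax Atx]; first exact: leq_ltn_trans B3 cardB.
(* Here |A| <= 4. A second overlap point [x] would confine t(B) to A minus p and x, at most two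
   points, but |B| > 2. *)
apply/eqP; apply: contraTT B3 => xp; rewrite -leqNgt.
rewrite -(card_imset _ (@perm_inj _ t)) -ltnS -ltnS.
apply: leq_trans S4.
rewrite -cardA (cardsD1 p A) Ap (cardsD1 x (A :\ p)) in_setD1 xp Ax.
rewrite !ltnS subset_leq_card //; apply/subsetP=> z tBz.
rewrite in_setD1 (subsetP sBA) // andbT.
by have [w Bw ->] := imsetP tBz; apply: tB.
Qed.

(** * Toggles on one half of a family *)

Definition half (E : finType) (L : {set {set E}}) (e : E) (b : bool) :=
  [set X in L | (e \in X) == b].

Section HalfFamily.
Variables (E : finType) (L : {set {set E}}) (e : E) (b : bool).
Local Notation A := (half L e b).

Lemma in_toggle X g : g != e -> (g \in toggle L e X) = (g \in X).
Proof.
move=> ge; rewrite /toggle; do 2?case: ifP => _ //; rewrite !inE ?ge //.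
by rewrite (negPf ge).
Qed.

Lemma half_sub : A \subset L.
Proof. by apply/subsetP=> X; rewrite inE => /andP[]. Qed.

Lemma toggle_half X : X \in A -> toggle A e X = X.
Proof.
rewrite /toggle !inE eqxx; case/andP=> _ /eqP ->.
by case: b; rewrite /= andbF.
Qed.

Lemma toggle_half_neq g X : g != e -> X \in A -> toggle A g X = toggle L g X.
Proof.
move=> ge; rewrite /toggle !inE (eq_sym e) (negPf ge).
by case/andP=> _ /eqP ->; rewrite /= eqxx !andbT.
Qed.

Definition half_incl (X : {X | X \in A}) : {X | X \in L} :=
  exist _ (val X) (subsetP half_sub _ (valP X)).

Lemma half_incl_inj : injective half_incl.
Proof. by move=> X Y [] /val_inj. Qed.

Lemma half_incl_codom (X : {X | X \in L}) :
  (X \in codom half_incl) = (val X \in A).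
Proof.
apply/codomP/idP=> [[Y ->]|XA]; first by case: Y.
by exists (exist _ (val X) XA); exact: val_inj.
Qed.

(** Liftable permutations form a group, so generators suffice: the toggle at [e] is trivial on A and
    lifts to 1, any other one lifts to the same toggle of [L]. *)
Lemma lifts_toggle_group s : s \in toggle_group A ->
  exists2 h, h \in toggle_group L & lifts half_incl h s.
Proof.
move=> As; apply/exists_inP.
pose P := [set r | [exists h in toggle_group L, lifts half_incl h r]].
have gP : group_set P.
  apply/group_setP; split=> [|r1 r2].
    by rewrite inE; apply/exists_inP; exists 1; rewrite ?group1 ?lifts1.
  rewrite !inE => /exists_inP[h1 Lh1 l1] /exists_inP[h2 Lh2 l2].
  by apply/exists_inP; exists (h1 * h2); rewrite ?groupM ?liftsM.
suff /subsetP/(_ s As) : toggle_group A \subset Group gP by rewrite inE.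
rewrite gen_subG; apply/subsetP=> _ /imsetP[g _ ->]; rewrite inE.
apply/exists_inP; have [->|ge] := eqVneq g e.
  exists 1; rewrite ?group1 //; apply/liftsP=> X; apply: val_inj.
  by rewrite perm1 permE /= toggle_half // (valP X).
exists (toggle_perm L g); first by rewrite mem_gen ?imset_f.
apply/liftsP=> X; apply: val_inj.
by rewrite !permE /= toggle_half_neq // (valP X).
Qed.

Lemma toggle_alternating_half X Y :
    2 < #|A| -> toggle_alternating A ->
    A :|: toggle L e @: A = L ->
    X \in A -> toggle L e X \in A -> Y \in L -> Y \notin A ->
  toggle_alternating L.
Proof.
move=> A3 altA LE XA tXA YL YA.
have XL := subsetP half_sub _ XA.
apply: (Alt_sub_lift (f := half_incl) (t := toggle_perm L e)
  (p := exist _ X XL) (y := exist _ Y YL)).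
- exact: half_incl_inj.
- by rewrite card_sig.
- by move=> s /(subsetP altA); apply: lifts_toggle_group.
- by rewrite mem_gen ?imset_f.
- by move=> W; rewrite !permE toggle_mapK.
- move=> W; rewrite !half_incl_codom permE /= => WA.
  have : val W \in A :|: toggle L e @: A by rewrite LE (valP W).
  rewrite inE (negPf WA) => /imsetP[V VA ->].
  by rewrite toggleK // (subsetP half_sub).
- by rewrite half_incl_codom.
- by rewrite half_incl_codom permE.
- by rewrite half_incl_codom.
Qed.

(** Otherwise {g, h} would be a clump inside a maximal one, of which only one element survives in
    [E']. *)
Lemma essential_separated L' E' g h :
    essentialization L L' E' -> g \in E' -> h \in E' ->
    {in L, forall X : {set E}, (g \in X) = (h \in X)} -> g = h.
Proof.
case=> R [maxR _ -> _] gE hE gh; apply/eqP; apply: contraT => neq_gh.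
have cl : clump L [set g; h].
  rewrite /clump cards2 neq_gh; apply/'forall_in_forall_inP=> k + X XL.
  rewrite !inE subUset !sub1set (gh X XL) andbb.
  by case/orP=> /eqP->; rewrite ?(gh X XL) implybb.
have [Z maxZ sghZ] := maxset_exists cl.
have : #|[set g; h]| <= #|Z :\: R|.
  apply/subset_leq_card/subsetP=> k kgh; rewrite inE (subsetP sghZ) // andbT.
  by move: gE hE kgh; rewrite !inE => /andP[? _] /andP[? _] /orP[]/eqP->.
by rewrite maxR // cards2 neq_gh.
Qed.

(* An element g of E' other than e is determined by its trace                 *)
(* [set X in A | g \in X], a nonempty proper subset of A; for #|A| <= 2 there *)
(* are at most two of these.                                                  *)
Lemma card_half L' E' :
    essentialization L L' E' -> 5 <= #|E'| -> e \in E' ->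
    A :|: toggle L e @: A = L -> 2 < #|A|.
Proof.
move=> ess E5 eE LE; rewrite ltnNge; apply/negP=> A2.
pose tr (g : E) := [set X in A | g \in X].
have in_tr g X : (X \in tr g) = (X \in A) && (g \in X) by rewrite in_set.
(* Toggling [e] does not affect [g], so the covering of [L] reduces membership of [g] to members of
   A. *)
have LA X g : X \in L -> g != e -> exists2 W, W \in A & (g \in X) = (g \in W).
  rewrite -{1}LE inE => /orP[XA|/imsetP[W WA ->]] ge; first by exists X.
  by exists W; rewrite ?in_toggle.
have tr_inj : {in E' :\ e &, injective tr}.
  move=> g h; rewrite !inE => /andP[ge gE] /andP[he hE] trE.
  apply: (essential_separated ess gE hE) => X.
  rewrite -{1}LE inE => /orP[XA|/imsetP[W WA ->]]; last rewrite !in_toggle //.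
    by have /setP/(_ X) := trE; rewrite !in_tr XA.
  by have /setP/(_ W) := trE; rewrite !in_tr WA.
have sub : tr @: (E' :\ e) \subset powerset A :\ set0 :\ A.
  apply/subsetP=> _ /imsetP[g + ->]; rewrite in_setD1 => /andP[ge gE].
  have /andP[/exists_inP[X XL gX] /exists_inP[Y YL gY]] : essential L g.
    by case: ess gE => R [_ _ -> _]; rewrite !inE => /andP[].
  have [[W WA gW] [V VA gV]] := (LA X g XL ge, LA Y g YL ge).
  rewrite !in_setD1 powersetE; apply/and3P; split.
  - apply: contraNneq gY => trA; rewrite gV.
    by move: VA; rewrite -trA in_tr => /andP[].
  - by apply/set0Pn; exists W; rewrite in_tr WA -gW.
  - by apply/subsetP=> U; rewrite in_tr => /andP[].
have := subset_leq_card sub; rewrite (card_in_imset tr_inj).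
have A0 : A != set0.
  have /andP[/exists_inP[X XL _] _] : essential L e.
    by case: ess eE => R [_ _ -> _]; rewrite !inE => /andP[].
  apply: contraTneq XL => A0; rewrite -LE inE A0 in_set0.
  by apply/imsetP=> -[?]; rewrite in_set0.
rewrite leqNgt => /negP; apply.
have pow : #|powerset A| <= 4 by rewrite card_powerset (leq_exp2l _ 2).
move: E5; rewrite (cardsD1 e) eE ltnS; apply: leq_trans.
rewrite (cardsD1 set0) (cardsD1 A) in pow.
move: pow; rewrite in_setD1 !powersetE A0 sub0set subxx !add1n.
exact: ltnW.
Qed.

Lemma toggle_alternating_step L' E' :
    essentialization L L' E' -> 5 <= #|E'| -> e \in E' ->
    toggle_alternating A -> A :|: toggle L e @: A = L ->
    A :&: toggle L e @: A <> set0 ->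
  toggle_alternating L.
Proof.
move=> ess E5 eE altA LE /eqP/set0Pn[X].
rewrite inE => /andP[XA /imsetP[X' XA' XE]].
have A3 := card_half ess E5 eE LE.
have /andP[/exists_inP[Y YL eY] /exists_inP[Z ZL eZ]] : essential L e.
  by case: ess eE => R [_ _ -> _]; rewrite !inE => /andP[].
have [W WL WA] : exists2 W, W \in L & W \notin A.
  case: b; [exists Z | exists Y]; rewrite // inE.
    by rewrite (negPf eZ) andbF.
  by rewrite eY andbF.
by apply: toggle_alternating_half A3 altA LE XA' _ WL WA; rewrite -XE.
Qed.

End HalfFamily.

Theorem theorem2p22 (E : finType) (L : {set {set E}})
    (hL : inductively_toggle_alternating L) :
  toggle_alternating L.
Proof.
elim: hL => {L} [L L' E' _ _ //|L L' E' e ess E5 eE _|L L' E' e ess E5 eE _].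
- have -> : with_elt L e = half L e true by apply/setP=> X; rewrite !inE eqb_id.
  exact: toggle_alternating_step ess E5 eE.
- have -> : without_elt L e = half L e false.
    by apply/setP=> X; rewrite !inE eqbF_neg.
  exact: toggle_alternating_step ess E5 eE.
Qed.
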